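(* Let $\nu>0$ and assume either (geometric case) $N_n=N_0\Lambda^n$ with $N_0>0$, $\Lambda>1$, $\alpha>0$, or (super-exponential case) $N_n=N_0^{b^n}$ with $N_0>1$, $1<b<2$, $\alpha\ge0$. Let $h\in H_N^\infty$ be non-negative, let $u$ be a global non-negative Galerkin solution of $$\dot u_n+\nu N_n^{2\alpha}u_n=N_{n-1}u_{n-1}^2-N_nu_nu_{n+1}\quad(n\ge0),\qquad u_n(0)=h_n$$ (incoming term equal to $0$ for $n=0$), and let $[0,T_{\max})$ be its maximal smooth existence interval. Put $$\mathcal A(t):=\sum_{n\ge0}2^{-n}|\dot u_n(t)|^2 .$$ Then for every $0\le t_0\le t<T_{\max}$, $$\mathcal A(t)+2\int_{t_0}^t\sum_{n\ge0}2^{-n}\bigl(\nu N_n^{2\alpha}+N_nu_{n+1}(\tau)\bigr)|\dot u_n(\tau)|^2\,\mathrm{d}\tau=\mathcal A(t_0).$$ In particular, $\mathcal A$ is non-increasing on $[0,T_{\max})$.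
   Context: For $s\in\mathbb R$, $H_N^s$ is the space of real sequences $u=(u_n)_{n\ge0}$ with $\|u\|_{H_N^s}^2=\sum_{n\ge0}N_n^{2s}|u_n|^2<\infty$, and $H_N^\infty=\bigcap_{s>0}H_N^s$. ''Non-negative'' means all coordinates are $\ge0$ (at all times, for a solution). A finite-energy solution on an interval $I\subset[0,\infty)$ is an $\ell^2$-valued map $u$ on $I$ whose coordinates $u_n$ belong to $C^1(I)$ and satisfy the equations for every $n\ge0$, with $u_n(0)=h_n$ if $0\in I$. It is smooth on $I$ if $\sup_{t\in J}\|u(t)\|_{H_N^s}<\infty$ for every compact interval $J\subset I$ and every $s>0$. A Galerkin solution is a global finite-energy solution obtained as the limit, locally uniformly in time in each fixed coordinate and along a subsequence $M_j\to\infty$, of the solutions $u^{(M)}$ of the finite systems consisting of the equations for $0\le n\le M$ with $u^{(M)}_{M+1}=0$ and initial values $h_0,\dots,h_M$. For non-negative $h\in H^\infty_N$ such a solution exists and is smooth on some interval $[0,\delta]$, $\delta>0$; $T_{\max}\in(0,\infty]$ is the supremum of the $T>0$ such that $u$ is smooth on $[0,T)$. (It is not assumed that $T_{\max}=\infty$.) The series defining $\mathcal A(t)$ converges for every $t<T_{\max}$. *)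

(* Defs.v *)
From HB Require Import structures.
From mathcomp Require Import all_boot all_order all_algebra.
From mathcomp Require Import all_classical all_reals all_analysis.
Import Order.TTheory GRing.Theory Num.Theory.
Import numFieldNormedType.Exports.

Set Implicit Arguments.
Unset Strict Implicit.
Unset Printing Implicit Defensive.

Local Open Scope classical_set_scope.
Local Open Scope ring_scope.

Section Derivative.
Context {R : realType}.

(* Derivatives relative to I: one-sided at an endpoint of I that belongs to I,
   where the library's two-sided derivative says nothing. *)
Definition diff_quotient (f : R -> R) (t s : R) : R := (f s - f t) / (s - t).

Definition derivable_in (I : set R) (f : R -> R) (t : R) : Prop :=
  cvg (diff_quotient f t @ within I t^').

Definition derive_in (I : set R) (f : R -> R) (t : R) : R :=
  lim (diff_quotient f t @ within I t^').

Definition C1_on (I : set R) (f : R -> R) : Prop :=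
  (forall t, I t -> derivable_in I f t) /\ {within I, continuous (derive_in I f)}.

End Derivative.

Section Model.
Context {R : realType}.
Implicit Types (N x h : nat -> R) (u v : nat -> R -> R) (I : set R).

Definition geometric_case N (alpha : R) : Prop :=
  exists N0 Lambda : R, [/\ 0 < N0, 1 < Lambda, 0 < alpha &
    forall n, N n = N0 * Lambda ^+ n].

Definition superexponential_case N (alpha : R) : Prop :=
  exists N0 b : R, [/\ 1 < N0, 1 < b < 2, 0 <= alpha &
    forall n, N n = N0 `^ (b ^+ n)].

(* Takes the value +oo outside of H_N^s. *)
Definition Hnorm N (s : R) x : \bar R :=
  sqrte (\sum_(0 <= n <oo) (N n `^ (2 * s) * `|x n| ^+ 2)%:E)%E.

Definition Hinfty N x : Prop := forall s : R, 0 < s -> (Hnorm N s x < +oo)%E.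

Definition ell2 x : Prop := (\sum_(0 <= n <oo) (`|x n| ^+ 2)%:E < +oo)%E.

Definition incoming N u (n : nat) (t : R) : R :=
  if n is m.+1 then N m * u m t ^+ 2 else 0.

Definition shell_equation (nu alpha : R) N I u (n : nat) : Prop :=
  forall t, I t ->
    derive_in I (u n) t + nu * N n `^ (2 * alpha) * u n t =
    incoming N u n t - N n * u n t * u n.+1 t.

Definition finite_energy_solution (nu alpha : R) N h I u : Prop :=
  [/\ forall t, I t -> ell2 (fun n => u n t),
      forall n, C1_on I (u n),
      forall n, shell_equation nu alpha N I u n &
      I 0 -> forall n, u n 0 = h n].

Definition smooth_on N I u : Prop :=
  forall a b : R, a <= b -> `[a, b] `<=` I ->
  forall s : R, 0 < s ->
    (ereal_sup [set Hnorm N s (fun n => u n t) | t in `[a, b]] < +oo)%E.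

Definition halfline : set R := `[0, +oo[.

(* Only the coordinates v 0, ..., v M.+1 are constrained. *)
Definition galerkin_system (nu alpha : R) N h (M : nat) v : Prop :=
  [/\ forall n, (n <= M)%N -> C1_on halfline (v n),
      forall n, (n <= M)%N -> shell_equation nu alpha N halfline v n,
      forall t, halfline t -> v M.+1 t = 0 &
      forall n, (n <= M)%N -> v n 0 = h n].

Definition galerkin_solution (nu alpha : R) N h u : Prop :=
  finite_energy_solution nu alpha N h halfline u /\
  exists (M : nat -> nat) (v : nat -> nat -> R -> R),
    [/\ {homo M : i j / (i < j)%N},
        forall j, galerkin_system nu alpha N h (M j) (v j) &
        forall n (T : R), 0 < T ->
          {uniform `[0, T], (fun j => v j n) @ \oo --> u n}].

Definition Tmax N u : \bar R :=
  ereal_sup [set T%:E | T in [set T : R | 0 < T /\ smooth_on N `[0, T[ u]].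

Definition udot u (n : nat) (t : R) : R := derive_in halfline (u n) t.

(* Sums of non-negative terms, hence taken in [0, +oo]. *)
Definition activity u (t : R) : \bar R :=
  (\sum_(0 <= n <oo) (2 ^- n * `|udot u n t| ^+ 2)%:E)%E.

Definition dissipation (nu alpha : R) N u (t : R) : \bar R :=
  (\sum_(0 <= n <oo) (2 ^- n * (nu * N n `^ (2 * alpha) + N n * u n.+1 t)
                       * `|udot u n t| ^+ 2)%:E)%E.

End Model.

(* Main.v *)
(* Differentiating the equation for u_n, the time derivatives v_n = u_n'
   satisfy
     v_n' = - (nu N_n^(2 alpha) + N_n u_(n+1)) v_n
            + 2 N_(n-1) u_(n-1) v_(n-1) - N_n u_n v_(n+1).
   Summing 2^-n v_n v_n' over n <= M, the mixed terms telescope to the single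
   flux 2^-M N_M u_M v_M v_(M+1). Smoothness bounds N_n u_n and v_n uniformly
   in n and in time, so this flux is O(2^-M) and disappears as M tends to
   infinity. *)

Require Import Defs.
From mathcomp Require Import all_boot all_order all_algebra.
From mathcomp Require Import all_classical all_reals all_analysis.
From mathcomp Require Import ring lra.
Import Order.TTheory GRing.Theory Num.Theory.
Import numFieldNormedType.Exports.
Local Open Scope classical_set_scope.
Local Open Scope ring_scope.
Set Implicit Arguments.
Unset Strict Implicit.
Unset Printing Implicit Defensive.

(** * Derivatives relative to a set and the fundamental theorem of calculus *)

Lemma derivable_in_continuous (R : realType) (I : set R) (f : R -> R) (t : R) :
  derivable_in I f t -> f @ within I (nbhs t) --> f t.
Proof.
move=> /cvg_ex[l fl].
have FtI : Filter (within I t^') by exact: within_filter.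
have idt : s @[s --> within I t^'] --> t.
  by move=> A At; exact: (filterS (fun s As _ _ => As) At).
(* Off [t] this function is [f] itself, and its second term tends to [l * 0]. *)
have ft : (fun s => f t + diff_quotient f t s * (s - t)) @ within I t^' --> f t.
  rewrite -[X in _ --> X]addr0 -(mulr0 l); apply: cvgD; first exact: cvg_cst.
  apply: cvgM => //; rewrite -(subrr t); apply: cvgB => //; exact: cvg_cst.
have FnI : Filter (within I (nbhs t)) by exact: within_filter.
apply/cvgrPdist_lt => e e0; move/cvgrPdist_lt : ft => /(_ _ e0).
rewrite !near_withinE => ft.
near=> s => Is.
have [->|st] := eqVneq s t; first by rewrite subrr normr0.
suff -> : f s = f t + diff_quotient f t s * (s - t).
  by move: st Is; near: s.
by rewrite /diff_quotient divfK ?subr_eq0// addrC subrK.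
Unshelve. all: by end_near.
Qed.

Lemma within_dnbhs (R : realType) (I : set R) (t : R) :
  nbhs t I -> within I t^' = t^'.
Proof.
move=> tI; apply/seteqP; split => A At.
  by apply: (filterS2 _ _ tI At) => s Is As st; exact: As.
by apply: filterS At => s As _.
Qed.

Lemma is_derive_derive_in (R : realType) (I : set R) (f : R -> R) (t : R) :
  nbhs t I -> derivable_in I f t -> is_derive t 1 f (derive_in I f t).
Proof.
rewrite /derivable_in /derive_in => /within_dnbhs -> df.
apply/is_derive1_caratheodory.
set l := lim _ in df *.
(* Carathéodory's slope function. At [z = t] the quotient is [0 / 0], which evaluates to 0, so the
   limit [l] is put in by hand. *)
exists (fun z => if z == t then l else diff_quotient f t z).
split; last by rewrite eqxx.
- move=> z; case: eqVneq => [->|zt]; first by rewrite !subrr mulr0.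
  by rewrite /diff_quotient divfK// subr_eq0.
- rewrite /prop_for /continuous_at eqxx; apply/cvgrPdist_lt => e e0.
  move/cvgrPdist_lt : df => /(_ _ e0); rewrite near_withinE => ft.
  near=> s; case: eqVneq => [_|st]; first by rewrite subrr normr0.
  by move: st; near: s.
Unshelve. all: by end_near.
Qed.

(** A derivative is asked for only at interior points, since at time 0 the solution is only known to
    have a one-sided one. The degenerate case [a = b] is included because the balance is also
    claimed for [t0 = t]. *)
Lemma FTC2_is_derive (R : realType) (f F : R -> R) (a b : R) : a <= b ->
  {within `[a, b], continuous F} -> {within `[a, b], continuous f} ->
  (forall t, a < t < b -> is_derive t 1 F (f t)) ->
  \int[lebesgue_measure]_(t in `[a, b]) f t = F b - F a.
Proof.
rewrite le_eqVlt => /predU1P[-> _ _ _|ab cF cf dF].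
  by rewrite set_itv1 Rintegral_set1 subrr.
rewrite /Rintegral (@continuous_FTC2 _ _ F)// ?EFinB//.
- have [_ Fa Fb] := (continuous_within_itvP F ab).1 cF.
  split=> // t; rewrite in_itv/= => /dF dFt; exact: ex_derive.
- by move=> t; rewrite in_itv/= => /dF dFt; rewrite derive1E derive_val.
Qed.

(** * Velocity, flux and dissipation of a single mode *)

(** The shell equation solved for the time derivative. As a polynomial in at most three neighbouring
    modes it inherits continuity and differentiability from [u], so second derivatives of [u] come
    for free. *)
Definition velocity {R : realType} (nu alpha : R) (N : nat -> R)
    (u : nat -> R -> R) (n : nat) (t : R) : R :=
  incoming N u n t - N n * u n t * u n.+1 t - nu * N n `^ (2 * alpha) * u n t.

(* [flux k] is the interaction of modes k-1 and k: it enters mode k and leaves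
   mode k-1. *)
Definition flux {R : realType} (nu alpha : R) (N : nat -> R)
    (u : nat -> R -> R) (k : nat) (t : R) : R :=
  if k is m.+1 then
    2 ^- m * (N m * u m t *
              velocity nu alpha N u m t * velocity nu alpha N u k t)
  else 0.

Definition dissipation_mode {R : realType} (nu alpha : R) (N : nat -> R)
    (u : nat -> R -> R) (n : nat) (t : R) : R :=
  2 ^- n * (nu * N n `^ (2 * alpha) + N n * u n.+1 t) *
    velocity nu alpha N u n t ^+ 2.

Lemma velocity_cvg (R : realType) (nu alpha : R) (N : nat -> R)
    (u : nat -> R -> R) (n : nat) (A : set R) (t : R) :
  (forall m, u m @ within A (nbhs t) --> u m t) ->
  velocity nu alpha N u n @ within A (nbhs t) --> velocity nu alpha N u n t.
Proof.
move=> ut.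
have FA : Filter (within A (nbhs t)) by exact: within_filter.
apply: cvgB; [apply: cvgB|]; last by apply: cvgM => //; exact: cvg_cst.
  case: n => [|m] /=; first exact: cvg_cst.
  apply: cvgM; first exact: cvg_cst.
  by under eq_fun do rewrite expr2; rewrite expr2; apply: cvgM.
by apply: cvgM => //; apply: cvgM => //; exact: cvg_cst.
Qed.

Lemma flux_cvg (R : realType) (nu alpha : R) (N : nat -> R)
    (u : nat -> R -> R) (n : nat) (A : set R) (t : R) :
  (forall m, u m @ within A (nbhs t) --> u m t) ->
  flux nu alpha N u n @ within A (nbhs t) --> flux nu alpha N u n t.
Proof.
move=> ut.
have FA : Filter (within A (nbhs t)) by exact: within_filter.
case: n => [|m] /=; first exact: cvg_cst.
apply: cvgM; first exact: cvg_cst.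
apply: cvgM; last exact: velocity_cvg.
apply: cvgM; last exact: velocity_cvg.
by apply: cvgM => //; exact: cvg_cst.
Qed.

Lemma dissipation_mode_cvg (R : realType) (nu alpha : R) (N : nat -> R)
    (u : nat -> R -> R) (n : nat) (A : set R) (t : R) :
  (forall m, u m @ within A (nbhs t) --> u m t) ->
  dissipation_mode nu alpha N u n @ within A (nbhs t) -->
    dissipation_mode nu alpha N u n t.
Proof.
move=> ut.
have FA : Filter (within A (nbhs t)) by exact: within_filter.
have vt := @velocity_cvg _ nu alpha N u n A t ut.
rewrite /dissipation_mode expr2; under eq_fun do rewrite expr2.
apply: cvgM; last exact: cvgM.
apply: cvgM; first exact: cvg_cst.
by apply: cvgD; [exact: cvg_cst|apply: cvgM => //; exact: cvg_cst].
Qed.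

(** This is where the weight [2 ^- n] is used: differentiating the square [u m t ^+ 2] in the
    incoming term yields a factor 2, and [2 * 2 ^- m.+1 = 2 ^- m]. Hence what mode [m.+1] gains is
    exactly what mode [m] loses. *)
Lemma is_derive_weighted_velocity (R : realType) (nu alpha : R) (N : nat -> R)
    (u : nat -> R -> R) (n : nat) (t : R) :
  (forall m, is_derive t 1 (u m) (velocity nu alpha N u m t)) ->
  is_derive t 1 (fun s => 2 ^- n * velocity nu alpha N u n s ^+ 2)
    (2 * (flux nu alpha N u n t - flux nu alpha N u n.+1 t
          - dissipation_mode nu alpha N u n t)).
Proof.
move=> du.
set v := velocity nu alpha N u.
set k := nu * N n `^ (2 * alpha).
pose d := if n is m.+1 then 2 * N m * u m t * v m t else 0.
have dinc : is_derive t 1 (incoming N u n) d.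
  rewrite /d; case: n @k @d => [|m] _ _; first exact: is_derive_cst.
  apply: (@is_derive_eq _ _ _ _ _ _ _ _
    (is_deriveZ (N m) (is_deriveX 2 (du m)))).
  by rewrite /GRing.scale/= /v; ring.
have dv : is_derive t 1 (v n)
   (d - (N n * v n t * u n.+1 t + N n * u n t * v n.+1 t) - k * v n t).
  apply: (@is_derive_eq _ _ _ _ _ _ _ _ (is_deriveB (is_deriveB dinc
     (is_deriveM (is_deriveZ (N n) (du n)) (du n.+1))) (is_deriveZ k (du n)))).
  by rewrite /GRing.scale/= /GRing.scale/= /v; ring.
apply: (@is_derive_eq _ _ _ _ _ _ _ _ (is_deriveZ (2 ^- n) (is_deriveX 2 dv))).
rewrite /GRing.scale/= /dissipation_mode -/v -/k /flux /d.
case: n @k @d dinc dv => [|m] k d dinc dv.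
  by rewrite -/v expr0 invr1; ring.
by rewrite -/v exprS; field; rewrite expf_neq0 ?pnatr_eq0.
Qed.

(** The comparison takes place in [[0, +oo]]: the partial sums differ by a real null sequence, and
    adding the finite limit 0 to a possibly infinite sum is unambiguous. *)
Lemma nneseries_eq_of_cvg0 (R : realType) (x z e : nat -> R) :
  (forall n, 0 <= x n) -> (forall n, 0 <= z n) -> e @ \oo --> 0 ->
  (forall M, \sum_(0 <= n < M) x n = \sum_(0 <= n < M) z n - e M) ->
  (\sum_(0 <= n <oo) (x n)%:E = \sum_(0 <= n <oo) (z n)%:E)%E.
Proof.
move=> x0 z0 e0 xze.
have cz : cvgn (fun M => \sum_(0 <= n < M) (z n)%:E)%E.
  by apply: is_cvg_nneseries => n _ _; rewrite lee_fin.
have ce : (fun M => (- e M)%:E) @ \oo --> 0%E.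
  apply: cvg_EFin; first exact: nearW.
  by rewrite -oppr0; exact: cvgN.
have czx : (fun M => \sum_(0 <= n < M) (z n)%:E + (- e M)%:E)%E @ \oo -->
    (\sum_(0 <= n <oo) (z n)%:E)%E.
  by rewrite -[X in _ --> X]adde0; apply: cvgeD => //; exact: fin_num_adde_defl.
have -> : (fun M => \sum_(0 <= n < M) (x n)%:E)%E =
          (fun M => \sum_(0 <= n < M) (z n)%:E + (- e M)%:E)%E.
  by apply/funext => M; rewrite !sumEFin xze EFinD.
exact/cvg_lim.
Qed.

(** * Bounds uniform in the mode and in time *)

(** A single term of a non-negative series is at most its sum, so each weighted coordinate is at
    most the norm, and the supremum of the norms over [[a, b]] serves as [C]. *)
Lemma smooth_on_coord_bound (R : realType) (N : nat -> R) (I : set R)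
    (u : nat -> R -> R) (a b s : R) :
  smooth_on N I u -> a <= b -> `[a, b] `<=` I -> 0 < s ->
  exists C, forall n t, a <= t <= b -> N n `^ s * `|u n t| <= C.
Proof.
move=> smu ab abI s0; have := smu a b ab abI s s0.
set S := ereal_sup _ => Sy.
have HS t : a <= t <= b -> (Hnorm N s (fun n => u n t) <= S)%E.
  by move=> abt; apply: ereal_sup_ubound; exists t => //=; rewrite in_itv.
have S0 : (0 <= S)%E.
  by apply: le_trans (HS a _); rewrite ?sqrte_ge0 ?lexx.
exists (fine S) => n t abt; rewrite -lee_fin fineK ?ge0_fin_numE//.
apply: le_trans (HS t abt).
pose f m := (N m `^ (2 * s) * `|u m t| ^+ 2)%:E.
have f0 m : (0 <= f m)%E by rewrite lee_fin mulr_ge0 ?powR_ge0.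
have -> : (N n `^ s * `|u n t|)%:E = sqrte (f n).
  rewrite /f /= [2 * s]mulrC powRrM powR_mulrn ?powR_ge0// -exprMn.
  by rewrite sqrtr_sqr normrM normr_id ger0_norm ?powR_ge0.
rewrite lee_sqrt; last by apply: nneseries_ge0 => m _ _; exact: f0.
apply: le_trans (nneseries_lim_ge n.+1 (fun m _ _ => f0 m)).
by rewrite big_nat_recr//= leeDr// sume_ge0.
Qed.

(** Allows a bound on [N n * u n t] to be divided by [c] into a bound on [u n t]. In the geometric
    case [N 0] may be below 1, hence a general [c]. *)
Lemma scale_lower_bound (R : realType) (N : nat -> R) (alpha : R) :
  geometric_case N alpha \/ superexponential_case N alpha ->
  exists2 c, 0 < c & forall n, c <= N n.
Proof.
case=> [[N0 [L [N00 L1 _ NE]]]|[N0 [b [N01 /andP[b1 _] _ NE]]]].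
  by exists N0 => // n; rewrite NE ler_peMr ?exprn_ege1 1?ltW.
exists 1 => // n; rewrite NE -(powRr0 N0) ler_powR 1?ltW// exprn_gt0//.
exact: lt_trans b1.
Qed.

Lemma damping_le_powR (R : realType) (N : nat -> R) (alpha : R) :
  geometric_case N alpha \/ superexponential_case N alpha ->
  exists2 s, 0 < s & forall n, N n `^ (2 * alpha) <= N n `^ s.
Proof.
case=> [[N0 [L [_ _ al0 _]]]|[N0 [b [N01 /andP[b1 _] al0 NE]]]].
  by exists (2 * alpha) => //; rewrite mulr_gt0.
exists (2 * alpha + 1) => [|n]; first lra.
rewrite ler_powR ?lerDl// NE -(powRr0 N0) ler_powR 1?ltW// exprn_gt0//.
exact: lt_trans b1.
Qed.

Lemma velocity_bound (R : realType) (nu alpha : R) (N : nat -> R)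
    (I : set R) (u : nat -> R -> R) (a b : R) :
  0 <= nu -> geometric_case N alpha \/ superexponential_case N alpha ->
  smooth_on N I u -> a <= b -> `[a, b] `<=` I ->
  exists C, forall n t, a <= t <= b ->
    `|N n * u n t| <= C /\ `|velocity nu alpha N u n t| <= C.
Proof.
move=> nu0 HN smu ab abI.
have [c c0 cN] := scale_lower_bound HN.
have [s s0 Ns] := damping_le_powR HN.
have [C1 HC1] := smooth_on_coord_bound smu ab abI ltr01.
have [C2 HC2] := smooth_on_coord_bound smu ab abI s0.
have N0 n : 0 < N n := lt_le_trans c0 (cN n).
have Nu n t : a <= t <= b -> `|N n * u n t| <= C1.
  by move=> /(HC1 n); rewrite normrM powRr1 ?(gtr0_norm (N0 n)) ?(ltW (N0 n)).
have uC n t : a <= t <= b -> `|u n t| <= C1 / c.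
  move=> abt; rewrite ler_pdivlMr//; apply: le_trans (Nu n t abt).
  by rewrite normrM (gtr0_norm (N0 n)) [leLHS]mulrC ler_wpM2r.
have ku n t : a <= t <= b -> `|nu * N n `^ (2 * alpha) * u n t| <= nu * C2.
  move=> abt; rewrite -mulrA normrM ger0_norm// ler_wpM2l//.
  rewrite normrM ger0_norm ?powR_ge0//; apply: le_trans (HC2 n t abt).
  by rewrite ler_wpM2r.
have C10 : 0 <= C1 by apply: le_trans (Nu 0 a _); rewrite ?lexx.
(* Only one factor of a quadratic term has to absorb [N m]; the other is bounded by [C1 / c]. *)
have Nuu m n t : a <= t <= b -> `|N m * u m t * u n t| <= C1 * (C1 / c).
  by move=> abt; rewrite normrM ler_pM// ?Nu ?uC.
(* The last three summands bound the incoming, outgoing and damping terms of the velocity; the extra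
   [C1] lets the same constant bound [N n * u n t]. *)
exists (C1 + (C1 * (C1 / c) + C1 * (C1 / c) + nu * C2)) => n t abt.
have C20 : 0 <= nu * C2 := le_trans (normr_ge0 _) (ku n t abt).
have Cc0 : 0 <= C1 * (C1 / c) := le_trans (normr_ge0 _) (Nuu n n t abt).
split; first by have := Nu n t abt; lra.
apply: le_trans (_ : C1 * (C1 / c) + C1 * (C1 / c) + nu * C2 <= _); last lra.
apply: (le_trans (ler_normB _ _)); apply: lerD; last exact: ku.
apply: (le_trans (ler_normB _ _)); apply: lerD; last exact: Nuu.
by case: n => [|m] /=; rewrite ?normr0// expr2 mulrA Nuu.
Qed.

(** * The balance integrated in time, and the vanishing of the flux *)

Lemma continuous_itv_integrable (R : realType) (f : R -> R) (a b : R) :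
  (forall t, t \in `[a, b] -> f @ within `[a, b] (nbhs t) --> f t) ->
  lebesgue_measure.-integrable `[a, b] (EFin \o f).
Proof.
move=> cf; apply: continuous_compact_integrable; first exact: segment_compact.
exact/subspace_continuousP.
Qed.

(** The fundamental theorem applied to the weighted square of the velocity. The flux integrals stay
    separate as [J n] and [J n.+1], ready to telescope in the sum over [n]. *)
Lemma mode_balance (R : realType) (nu alpha : R) (N : nat -> R)
    (u : nat -> R -> R) (a b : R) (n : nat) :
  a <= b ->
  (forall m t, t \in `[a, b] -> u m @ within `[a, b] (nbhs t) --> u m t) ->
  (forall m t, a < t < b -> is_derive t 1 (u m) (velocity nu alpha N u m t)) ->
  let J k := \int[lebesgue_measure]_(t in `[a, b]) flux nu alpha N u k t in
  2 ^- n * velocity nu alpha N u n b ^+ 2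
  + 2 * \int[lebesgue_measure]_(t in `[a, b]) dissipation_mode nu alpha N u n t
  = 2 ^- n * velocity nu alpha N u n a ^+ 2 + 2 * J n - 2 * J n.+1.
Proof.
move=> ab cu du J.
have cv t : t \in `[a, b] ->
    velocity nu alpha N u n @ within `[a, b] (nbhs t) -->
    velocity nu alpha N u n t.
  by move=> abt; apply: velocity_cvg => m; exact: cu.
have cF k t : t \in `[a, b] -> flux nu alpha N u k @ within `[a, b] (nbhs t) -->
    flux nu alpha N u k t by move=> abt; apply: flux_cvg => m; exact: cu.
have cD t : t \in `[a, b] ->
    dissipation_mode nu alpha N u n @ within `[a, b] (nbhs t) -->
    dissipation_mode nu alpha N u n t.
  by move=> abt; apply: dissipation_mode_cvg => m; exact: cu.
have cW t : t \in `[a, b] ->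
    (fun s => 2 ^- n * velocity nu alpha N u n s ^+ 2) @ within `[a, b] (nbhs t)
    --> 2 ^- n * velocity nu alpha N u n t ^+ 2.
  move=> abt; rewrite expr2; under eq_fun do rewrite expr2.
  apply: cvgM; first exact: cvg_cst.
  by apply: cvgM; exact: cv.
have iF k := continuous_itv_integrable (cF k).
have iD := continuous_itv_integrable cD.
have mab : measurable (`[a, b] : set (measurableTypeR R)).
  exact: measurable_itv.
have : \int[lebesgue_measure]_(t in `[a, b])
    (2 * (flux nu alpha N u n t - flux nu alpha N u n.+1 t
          - dissipation_mode nu alpha N u n t)) =
    2 ^- n * velocity nu alpha N u n b ^+ 2
    - 2 ^- n * velocity nu alpha N u n a ^+ 2.
  apply: (@FTC2_is_derive _ _
    (fun t => 2 ^- n * velocity nu alpha N u n t ^+ 2)) => //.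
  - by apply/subspace_continuousP => t abt; exact: cW.
  - apply/subspace_continuousP => t abt.
    apply: cvgM; first exact: cvg_cst.
    by apply: cvgB; [apply: cvgB; exact: cF|exact: cD].
  - by move=> t abt; apply: is_derive_weighted_velocity => m; exact: du.
have iFF : lebesgue_measure.-integrable `[a, b]
    (EFin \o (fun t => flux nu alpha N u n t - flux nu alpha N u n.+1 t)).
  by apply: continuous_itv_integrable => t abt; apply: cvgB; exact: cF.
rewrite RintegralZl//; last first.
  apply: continuous_itv_integrable => t abt.
  by apply: cvgB; [apply: cvgB; exact: cF|exact: cD].
by rewrite RintegralB// RintegralB// -/(J n) -/(J n.+1); lra.
Qed.

(** The flux into mode [k = m.+1] carries the weight [2 ^- m = 2 * 2 ^- k], whence the factor 2;
    each of its other three factors is at most [C]. *)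
Lemma flux_bound (R : realType) (nu alpha C t : R) (N : nat -> R)
    (u : nat -> R -> R) (k : nat) :
  (forall n, `|N n * u n t| <= C /\ `|velocity nu alpha N u n t| <= C) ->
  `|flux nu alpha N u k t| <= geometric (2 * C ^+ 3) 2^-1 k.
Proof.
move=> uC; have C0 : 0 <= C := le_trans (normr_ge0 _) (uC 0).1.
case: k => [|m] /=; first by rewrite normr0 expr0 mulr1 mulr_ge0 ?exprn_ge0.
rewrite [leRHS](_ : _ = 2 ^- m * (C * C * C)); last first.
  by rewrite exprVn [2 ^+ m.+1]exprS; field; rewrite expf_neq0.
rewrite normrM ger0_norm// ler_wpM2l// !normrM -normrM.
by rewrite !ler_pM ?mulr_ge0//; apply uC.
Qed.

Lemma Rintegral_flux_cvg0 (R : realType) (nu alpha C : R) (N : nat -> R)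
    (u : nat -> R -> R) (a b : R) :
  a <= b ->
  (forall m t, t \in `[a, b] -> u m @ within `[a, b] (nbhs t) --> u m t) ->
  (forall n t, a <= t <= b ->
    `|N n * u n t| <= C /\ `|velocity nu alpha N u n t| <= C) ->
  (fun k => \int[lebesgue_measure]_(t in `[a, b]) flux nu alpha N u k t) @ \oo
    --> 0.
Proof.
move=> ab cu uC.
have mab : measurable (`[a, b] : set (measurableTypeR R)).
  exact: measurable_itv.
pose g := geometric (2 * C ^+ 3 * fine (lebesgue_measure `[a, b])) (2^-1 : R).
have g0 : g @ \oo --> 0.
  by apply: cvg_geometric; rewrite ger0_norm ?invf_lt1 ?ltr1n.
have Jg k :
    `|\int[lebesgue_measure]_(t in `[a, b]) flux nu alpha N u k t| <= g k.
  have iF : lebesgue_measure.-integrable `[a, b] (EFin \o flux nu alpha N u k).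
    apply: continuous_itv_integrable => t abt.
    by apply: flux_cvg => m; exact: cu.
  apply: (le_trans (le_normr_Rintegral mab iF)).
  rewrite [leRHS](_ : _ =
    \int[lebesgue_measure]_(t in `[a, b]) geometric (2 * C ^+ 3) 2^-1 k);
    last first.
    by rewrite Rintegral_cst// /g/= mulrAC.
  apply: le_Rintegral => //.
  - exact: integrable_norm.
  - by apply: continuous_itv_integrable => t abt; exact: cvg_cst.
  - by move=> t; rewrite /= in_itv /= => abt; apply: flux_bound => n; exact: uC.
apply: (@squeeze_cvgr _ _ _ _ (- g) g) => //; last first.
  by rewrite -oppr0; exact: cvgN.
by apply: nearW => k; rewrite -ler_norml.
Qed.

(** Non-negativity of [u] makes every dissipation mode non-negative, so sum and integral may be
    exchanged by monotone convergence. The mode balances are then added up, and the remaining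
    boundary flux tends to 0. *)
Lemma activity_balance (R : realType) (nu alpha C : R) (N : nat -> R)
    (u : nat -> R -> R) (a b : R) :
  a <= b -> 0 <= nu -> (forall n, 0 <= N n) ->
  (forall n t, a <= t <= b -> 0 <= u n t) ->
  (forall m t, t \in `[a, b] -> u m @ within `[a, b] (nbhs t) --> u m t) ->
  (forall m t, a < t < b -> is_derive t 1 (u m) (velocity nu alpha N u m t)) ->
  (forall n t, a <= t <= b ->
    `|N n * u n t| <= C /\ `|velocity nu alpha N u n t| <= C) ->
  (\sum_(0 <= n <oo) (2 ^- n * velocity nu alpha N u n b ^+ 2)%:E
   + 2%:E * \int[lebesgue_measure]_(t in `[a, b])
              \sum_(0 <= n <oo) (dissipation_mode nu alpha N u n t)%:E
   = \sum_(0 <= n <oo) (2 ^- n * velocity nu alpha N u n a ^+ 2)%:E)%E.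
Proof.
move=> ab nu0 N0 u0 cu du uC.
have mab : measurable (`[a, b] : set (measurableTypeR R)).
  exact: measurable_itv.
have D0 n t : a <= t <= b -> 0 <= dissipation_mode nu alpha N u n t.
  move=> abt; rewrite /dissipation_mode mulr_ge0 ?sqr_ge0// mulr_ge0//.
  by rewrite addr_ge0// mulr_ge0 ?powR_ge0// u0.
have iD n : lebesgue_measure.-integrable `[a, b]
    (EFin \o dissipation_mode nu alpha N u n).
  apply: continuous_itv_integrable => t abt.
  by apply: dissipation_mode_cvg => m; exact: cu.
have x0 n t : 0 <= 2 ^- n * velocity nu alpha N u n t ^+ 2.
  by rewrite mulr_ge0 ?sqr_ge0.
have I0 n : 0 <= 2 * \int[lebesgue_measure]_(t in `[a, b])
                       dissipation_mode nu alpha N u n t.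
  rewrite mulr_ge0// Rintegral_ge0// => t; rewrite /= in_itv/=; exact: D0.
rewrite integral_nneseries//; last first.
  by move=> n; exact: measurable_int (iD n).
rewrite -nneseriesZl; last first.
  move=> n _; apply: integral_ge0 => t.
  by rewrite /= in_itv/= lee_fin; exact: D0.
rewrite [X in (_ + X)%E](eq_eseriesr (g := fun n =>
    (2 * \int[lebesgue_measure]_(t in `[a, b])
           dissipation_mode nu alpha N u n t)%:E)); last first.
  move=> n _; rewrite EFinM /Rintegral fineK// integrable_fin_num//.
  exact: iD.
rewrite -nneseriesD; last 2 first.
- by move=> n _ _; rewrite lee_fin.
- by move=> n _ _; rewrite lee_fin.
under eq_eseriesr do rewrite -EFinD.
pose J k := \int[lebesgue_measure]_(t in `[a, b]) flux nu alpha N u k t.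
(* The modes [n < M] lose energy only through the flux into mode [M], so the error is [2 * J M]. *)
apply: (@nneseries_eq_of_cvg0 _ _ _ (fun M => 2 * J M)) => //.
- by move=> n; rewrite addr_ge0.
- rewrite -(mulr0 2); apply: cvgM; first exact: cvg_cst.
  exact: Rintegral_flux_cvg0 uC.
- elim=> [|M IH].
    (* Nothing flows into mode 0, so [J 0 = 0]. *)
    by rewrite !big_geq// /J /= Rintegral_cst// mul0r mulr0 subrr.
  rewrite !big_nat_recr//= IH mode_balance//= -/(J M) -/(J M.+1); ring.
Qed.

(** * Finiteness of the activity and passage to the solution *)

Lemma activity_series_lty (R : realType) (v : nat -> R) (C : R) :
  (forall n, `|v n| <= C) ->
  (\sum_(0 <= n <oo) (2 ^- n * v n ^+ 2)%:E < +oo)%E.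
Proof.
move=> vC.
apply: (@le_lt_trans _ _ (2 * C ^+ 2)%:E); last exact: ltry.
apply: lime_le.
  by apply: is_cvg_nneseries => n _ _; rewrite lee_fin mulr_ge0 ?sqr_ge0.
apply: nearW => M; rewrite sumEFin lee_fin.
apply: (@le_trans _ _ (\sum_(0 <= n < M) 2 ^- n * C ^+ 2)).
  apply: ler_sum => n _; rewrite ler_wpM2l// -[leLHS]real_normK ?num_real//.
  by rewrite ler_pXn2r ?nnegrE// (le_trans _ (vC n)).
rewrite -mulr_suml ler_wpM2r ?sqr_ge0//.
(* The closed form shows that the partial sums of the weights stay below 2. *)
suff -> : \sum_(0 <= n < M) 2 ^- n = 2 - 2 * 2 ^- M :> R.
  by rewrite gerBl mulr_ge0.
elim: M => [|M IH]; first by rewrite big_geq// expr0 invr1; ring.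
by rewrite big_nat_recr//= IH exprS; field; rewrite expf_neq0.
Qed.

(** The strict gap [t < T] places the compact interval up to [t] inside [[0, T[], where smoothness
    gives uniform bounds. *)
Lemma smooth_before_Tmax (R : realType) (N : nat -> R) (u : nat -> R -> R)
    (t : R) :
  (t%:E < Tmax N u)%E -> exists2 T, t < T & smooth_on N `[0, T[ u.
Proof.
move=> /ereal_sup_gt[_ [T [_ smu] <-]]; rewrite lte_fin => tT.
by exists T.
Qed.

Lemma udotE (R : realType) (nu alpha : R) (N h : nat -> R) (u : nat -> R -> R)
    (n : nat) (t : R) :
  finite_energy_solution nu alpha N h halfline u -> 0 <= t ->
  udot u n t = velocity nu alpha N u n t.
Proof.
case=> _ _ eqs _ t0.
have /eqs : halfline t by rewrite /halfline /= in_itv /= t0.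
by move=> /(_ n); rewrite /udot /velocity => <-; ring.
Qed.

Theorem theorem3p3 (R : realType) (nu alpha : R) (N h : nat -> R)
    (u : nat -> R -> R) :
  0 < nu ->
  geometric_case N alpha \/ superexponential_case N alpha ->
  Hinfty N h ->
  (forall n, 0 <= h n) ->
  galerkin_solution nu alpha N h u ->
  (forall n t, 0 <= t -> 0 <= u n t) ->
  [/\ forall t : R, 0 <= t -> (t%:E < Tmax N u)%E -> (activity u t < +oo)%E,
      forall t0 t : R, 0 <= t0 -> t0 <= t -> (t%:E < Tmax N u)%E ->
        (activity u t
         + 2%:E * \int[lebesgue_measure]_(tau in `[t0, t])
                    dissipation nu alpha N u tau
         = activity u t0)%E &
      forall s t : R, 0 <= s -> s <= t -> (t%:E < Tmax N u)%E ->
        (activity u t <= activity u s)%E].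
Proof.
move=> nu0 HN _ _ [sol _] u0.
have [_ C1u _ _] := sol.
have [c c0 cN] := scale_lower_bound HN.
have N0 n : 0 <= N n := ltW (lt_le_trans c0 (cN n)).
have bound a b : 0 <= a -> a <= b -> (b%:E < Tmax N u)%E ->
    exists C, forall n t, a <= t <= b ->
      `|N n * u n t| <= C /\ `|velocity nu alpha N u n t| <= C.
  move=> a0 ab /smooth_before_Tmax[T bT smu].
  apply: (velocity_bound (ltW nu0) HN smu ab) => t /=.
  rewrite !in_itv/= => /andP[a_t tb].
  by rewrite (le_trans a0 a_t) (le_lt_trans tb).
have actE t : 0 <= t -> activity u t =
    (\sum_(0 <= n <oo) (2 ^- n * velocity nu alpha N u n t ^+ 2)%:E)%E.
  move=> t0; apply: eq_eseriesr => n _.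
  by rewrite (udotE n sol t0) real_normK ?num_real.
have disE t : 0 <= t -> dissipation nu alpha N u t =
    (\sum_(0 <= n <oo) (dissipation_mode nu alpha N u n t)%:E)%E.
  move=> t0; apply: eq_eseriesr => n _.
  by rewrite (udotE n sol t0) real_normK ?num_real.
have balance a b : 0 <= a -> a <= b -> (b%:E < Tmax N u)%E ->
    (activity u b + 2%:E * \int[lebesgue_measure]_(tau in `[a, b])
       dissipation nu alpha N u tau = activity u a)%E.
  move=> a0 ab bT; have [C uC] := bound a b a0 ab bT.
  rewrite !actE ?(le_trans a0 ab)//.
  have -> : (
      \int[lebesgue_measure]_(tau in `[a, b]) dissipation nu alpha N u tau =
      \int[lebesgue_measure]_(tau in `[a, b])
        \sum_(0 <= n <oo) (dissipation_mode nu alpha N u n tau)%:E)%E.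
    apply: eq_integral => t; rewrite inE /= in_itv/= => /andP[a_t _].
    by rewrite disE// (le_trans a0).
  apply: (activity_balance ab (ltW nu0) N0 _ _ _ uC).
  - by move=> n t /andP[a_t _]; rewrite u0// (le_trans a0).
  (* Differentiability relative to [halfline] gives continuity there, including from the right at 0,
     and continuity restricts to [[a, b]]. *)
  - move=> m; apply/subspace_continuousP.
    apply: (@continuous_subspaceW _ _ _ halfline).
      move=> t; rewrite /halfline /= !in_itv/= andbT => /andP[a_t _].
      exact: le_trans a_t.
    apply/subspace_continuousP => t /(C1u m).1.
    exact: derivable_in_continuous.
  (* Even for [a = 0] an interior time is positive, so [halfline] is a neighbourhood of it and the
     relative derivative is two-sided. *)
  - move=> m t /andP[a_t _]; have t0 : 0 < t := le_lt_trans a0 a_t.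
    rewrite -(udotE m sol (ltW t0)); apply: is_derive_derive_in.
      apply: filterS (lt_nbhsr t0) => s s0.
      by rewrite /halfline /= in_itv /= andbT ltW.
    by apply: (C1u m).1; rewrite /halfline /= in_itv /= ltW.
split=> //.
(* The uniform bound is used on the one-point interval [[t, t]]. *)
- move=> t t0 tT; have [C uC] := bound t t t0 (lexx t) tT.
  rewrite actE//; apply: (@activity_series_lty _ _ C) => n.
  by apply uC; rewrite lexx.
(* By the balance, the activity at [s] is the activity at [t] plus a non-negative integral. *)
- move=> s t s0 st tT; rewrite -(balance s t)// leeDl// mule_ge0//.
  apply: integral_ge0 => x; rewrite /= in_itv/= => /andP[sx _].
  have x0 := le_trans s0 sx.
  apply: nneseries_ge0 => n _ _; rewrite lee_fin mulr_ge0 ?sqr_ge0// mulr_ge0//.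
  by rewrite addr_ge0// mulr_ge0 ?powR_ge0 ?u0// ltW.
Qed.
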